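(* Let $p$ be a prime. Say that a finite group $X$ satisfies property $(\ast)_p$ if for every $\chi\in\operatorname{Irr}(X)$ with $a:=\nu_p(c(\chi))\ge1$, $[\mathbb{Q}_{p^a}(\chi):\mathbb{Q}_p(\chi)]$ divides $\chi(1)$. Let $G$ be a finite group and $N\trianglelefteq G$ with $p\nmid|G/N|$. (i) If $N$ satisfies $(\ast)_p$, then $G$ satisfies $(\ast)_p$. (ii) If $G/N$ is solvable and $G$ satisfies $(\ast)_p$, then $N$ satisfies $(\ast)_p$.
   Context: $\nu_p$ is the $p$-adic valuation. $\mathbb{Q}_n:=\mathbb{Q}(e^{2\pi i/n})$. $\mathbb{Q}(\chi)$ is the field of values of $\chi$, $c(\chi)$ is the smallest $n\ge1$ with $\mathbb{Q}(\chi)\subseteq\mathbb{Q}_n$, and $\mathbb{Q}_m(\chi)$ is the compositum of $\mathbb{Q}_m$ and $\mathbb{Q}(\chi)$. *)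

(* Defs.v *)
From HB Require Import structures.
From mathcomp Require Import all_boot all_order all_algebra all_fingroup all_solvable all_field all_character.
Set Implicit Arguments.
Unset Strict Implicit.
Unset Printing Implicit Defensive.
Import GRing.Theory Num.Theory.
Local Open Scope ring_scope.

(* x lies in Q_n = Q(e^{2 pi i/n}): x is a rational polynomial expression in a
   primitive n-th root of unity (Q_n does not depend on which one). *)
Definition inQn (n : nat) (x : algC) : Prop :=
  exists2 z : algC, n.-primitive_root z &
    exists q : {poly rat}, x = (map_poly ratr q).[z].

(* c(chi) = n : n is the smallest n >= 1 with Q(chi) contained in Q_n.
   (Q(chi) is generated by the values of chi, so Q(chi) <= Q_n iff all
   values of chi lie in the field Q_n.) *)
Definition is_conductor (gT : finGroupType) (X : {group gT}) (chi : 'CF(X))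
    (n : nat) : Prop :=
  [/\ (0 < n)%N, (forall x, inQn n (chi x)) &
      forall m, (0 < m)%N -> (forall x, inQn m (chi x)) -> (n <= m)%N].

Definition zeta (n : nat) : algC :=
  let: exist z _ := C_prim_root_exists (ltn0Sn n.-1) in z.

(* fdeg s t = [Q(t) : Q(s)] = \dim_Q Q(t) / \dim_Q Q(s) for finite lists
   s t of algebraic numbers, computed inside a number field Qs (a finite
   extension of rat) embedded in algC and containing all elements of s and t.
   When Q(s) is a subfield of Q(t) this is the degree of the extension. *)
Definition fdeg (s t : seq algC) : nat :=
  let: existT Qs (existT _ (exist2 s1 _ _)) := num_field_exists (s ++ t) in
  (\dim_(<<1 & take (size s) s1>>%VS) <<1 & drop (size s) s1>>%VS)%N.

Definition cfvals (gT : finGroupType) (X : {group gT}) (chi : 'CF(X)) :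
  seq algC := [seq chi x | x in X].

Definition star_prop (p : nat) (gT : finGroupType) (X : {group gT}) : Prop :=
  forall (i : Iirr X) (c : nat), is_conductor 'chi_i c ->
    let a := logn p c in
    (1 <= a)%N ->
    ((fdeg (zeta p :: cfvals 'chi_i) (zeta (p ^ a) :: cfvals 'chi_i))%:R
       %| 'chi_i 1%g)%C.

(* Main.v *)
Require Import Defs.
From HB Require Import structures.
From mathcomp Require Import all_boot all_order all_algebra all_fingroup all_solvable all_field all_character.
From mathcomp Require Import zify.
Set Implicit Arguments.
Unset Strict Implicit.
Unset Printing Implicit Defensive.
Import GRing.Theory Num.Theory.
Local Open Scope ring_scope.

(** Let l = |G| and, for d dividing l, let Z_d = Gal(Q_l/Q_d).  Gal(Q_l/Q) acts
    on the irreducible characters of all subgroups of G; let I_chi be the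
    stabilizer of chi.  Then [Q_{p^a}(chi) : Q_p(chi)] is the number of cosets of
    Z_{p^a} met by the intersection of Z_p and I_chi, and it is a power of p.
    Let chi in Irr(G) lie over theta in Irr(N), where p does not divide |G:N|.
    - A p-subgroup fixing chi permutes the constituents of chi_N, whose number is
      prime to p, so it fixes one of them, hence all of them, as it commutes with
      the transitive conjugation action of G.
    - A p-element fixing theta and the p'-th roots of unity fixes chi: when |G:N|
      is a prime q, theta either induces irreducibly or has q extensions, which
      differ by characters of G/N, and one of them is fixed since p <> q.
    Hence chi and theta have the same a, unless both have a <= 1.  Comparing the
    Sylow p-subgroups of the two intersections, the field degree for chi divides
    the one for theta; in prime index there is also a choice of chi, with
    chi(1)/theta(1) prime to p, for which the two degrees agree. *)

(** * Independence of the degree from the ambient number field *)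

Lemma zeta_prim n : (0 < n)%N -> n.-primitive_root (zeta n).
Proof.
by rewrite /zeta; case: n => // n _; case: (C_prim_root_exists _).
Qed.

(** Induction on the generators: an element of a simple extension is a polynomial in the last
    generator, and its coefficients lift by induction. *)
Lemma adjoin_seq_lift (K1 K2 : fieldExtType rat)
    (f1 : {rmorphism K1 -> algC}) (f2 : {rmorphism K2 -> algC}) s1 s2 :
    map f1 s1 = map f2 s2 ->
  forall x, x \in <<1 & s1>>%VS -> exists2 y, y \in <<1 & s2>>%VS & f1 x = f2 y.
Proof.
elim/last_ind: s1 s2 => [|s1 a IHs] s2.
  case: s2 => // _ x; rewrite Fadjoin_nil => /vlineP[c ->].
  by exists c%:A; rewrite ?memvZ ?mem1v // !rmorphZ_num !rmorph1.
case/lastP: s2 => [|s2 b]; first by rewrite map_rcons; case: (map f1 s1).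
rewrite !map_rcons => /rcons_inj[/IHs lift_s Dab] x.
rewrite !adjoin_rcons => /Fadjoin_polyP[p Kp ->].
have /fin_all_exists2[c Kc Dc] (i : 'I_(size p)) :
    exists2 y, y \in <<1 & s2>>%VS & f1 p`_i = f2 y.
  exact: lift_s (polyOverP Kp i).
exists (\sum_i c i * b ^+ i).
  rewrite rpred_sum // => i _; apply: rpredM; last exact/rpredX/memv_adjoin.
  exact: subvP_adjoin (Kc i).
rewrite horner_coef !rmorph_sum; apply: eq_bigr => i _.
by rewrite !rmorphM !rmorphXn /= Dc Dab.
Qed.

(** A rational relation between the lifts transports through [f2] and [f1] to one between the basis
    vectors of [U1]. *)
Lemma dim_lift_le (K1 K2 : fieldExtType rat)
    (f1 : {rmorphism K1 -> algC}) (f2 : {rmorphism K2 -> algC})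
    (U1 : {vspace K1}) (U2 : {vspace K2}) :
    (forall x, x \in U1 -> exists2 y, y \in U2 & f1 x = f2 y) ->
  (\dim U1 <= \dim U2)%N.
Proof.
move=> lift; set X := vbasis U1.
have /fin_all_exists2[y Uy Dy] (i : 'I_(\dim U1)) :
    exists2 y, y \in U2 & f1 X`_i = f2 y.
  by apply: lift; apply: vbasis_mem; rewrite mem_nth ?size_tuple.
pose Y := [tuple y i | i < \dim U1].
have freeY: free Y.
  apply/freeP => c cY0 i.
  have /freeP := basis_free (vbasisP U1); apply.
  apply: (fmorph_inj f1); rewrite rmorph0 -(rmorph0 f2) -cY0 !rmorph_sum.
  apply: eq_bigr => j _; rewrite !rmorphZ_num Dy; congr (_ * f2 _).
  by rewrite (nth_map j) ?size_enum_ord // nth_ord_enum.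
rewrite -[X in (X <= _)%N](size_tuple Y) -(eqP freeY) dimvS //.
by apply/span_subvP => _ /mapP[i _ ->].
Qed.

(** [fdeg] works in an opaque choice of number field; this frees it from that choice, so that
    degrees can be computed in a cyclotomic field. *)
Lemma fdegE (K : fieldExtType rat) (f : {rmorphism K -> algC}) s t :
  fdeg (map f s) (map f t) = (\dim_(<<1 & s>>%VS) <<1 & t>>%VS)%N.
Proof.
rewrite /fdeg; case: num_field_exists => K1 [f1 [r Dr _]].
have dimE u v : map f u = map f1 v -> \dim <<1 & u>>%VS = \dim <<1 & v>>%VS.
  move=> Duv; apply/eqP; rewrite eqn_leq.
  apply/andP; split.
    by apply: (@dim_lift_le _ _ f f1); apply: adjoin_seq_lift.
  by apply: (@dim_lift_le _ _ f1 f); apply: adjoin_seq_lift.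
congr (_ %/ _)%N; apply/esym/dimE.
  by rewrite map_drop Dr drop_size_cat ?size_map.
by rewrite map_take Dr take_size_cat ?size_map.
Qed.

(** * The fields Q_n and their intersections *)

Lemma inQnE n (z : algC) x : (0 < n)%N -> n.-primitive_root z ->
  inQn n x <-> exists q : {poly rat}, x = (map_poly ratr q).[z].
Proof.
move=> n_gt0 prim_z; split=> [[y prim_y [q ->]] | [q ->]]; last first.
  by exists z => //; exists q.
have [k ->] : exists k, y = z ^+ k.
  have [|i ->] := (prim_rootP prim_z) y; last by exists i.
  by rewrite (prim_expr_order prim_y).
by exists (q \Po 'X^k); rewrite map_comp_poly horner_comp map_polyXn hornerXn.
Qed.

Lemma prim_expr_div (R : nzRingType) (z : R) n d : (0 < n)%N -> (d %| n)%N ->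
  n.-primitive_root z -> d.-primitive_root (z ^+ (n %/ d)).
Proof.
move=> n_gt0 dv_d_n prim_z; have := exp_prim_root prim_z (n %/ d).
have [q Dn] := dvdnP dv_d_n; move: n_gt0; rewrite Dn muln_gt0 => /andP[q_gt0 d_gt0].
by rewrite mulnK // (gcdn_idPl (dvdn_mulr _ _)) ?mulKn.
Qed.

Lemma inQn_adjoin (K : fieldExtType rat) (f : {rmorphism K -> algC}) n y x :
  n.-primitive_root y -> inQn n x <-> exists2 a, a \in <<1; y>>%VS & x = f a.
Proof.
move=> prim_y; have n_gt0 := prim_order_gt0 prim_y.
have prim_fy : n.-primitive_root (f y) by rewrite fmorph_primitive_root.
apply: iff_trans (inQnE x n_gt0 prim_fy) _.
split=> [[q ->] | [_ /Fadjoin_polyP[p Qp ->] ->]].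
  exists (map_poly (in_alg K) q).[y].
    by apply: mempx_Fadjoin; apply/polyOverP => i; rewrite coef_map memvZ ?mem1v.
  rewrite -horner_map -map_poly_comp /=.
  congr (_.[_]); apply: eq_map_poly => c /=.
  by rewrite alg_num_field fmorph_rat.
have /fin_all_exists[c Dc] (i : 'I_(size p)) : exists c : rat, p`_i = c%:A.
  by have /vlineP := polyOverP Qp i.
(* The default 0 is never reached: [insub i] succeeds for every i below [size p]. *)
exists (\poly_(i < size p) (if insub i is Some j then c j else 0)).
rewrite -horner_map; congr (_.[_]).
apply/polyP=> i; rewrite !coef_map coef_poly.
case: ltnP => [lt_ip | /leq_sizeP/(_ i (leqnn i)) ->]; last first.
  by rewrite [LHS]rmorph0 [RHS]raddf0.
by case: insubP => [j _ <- | /negP//]; rewrite /= Dc alg_num_field fmorph_rat.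
Qed.

(** Galois correspondence for Q_l over Q_n; elements of the Galois group extend to [algC], where the
    hypothesis applies. *)
Lemma inQn_Galois n l x : (0 < l)%N -> (n %| l)%N -> inQn l x ->
    (forall u : {rmorphism algC -> algC},
       (forall z, z ^+ n = 1 -> u z = z) -> u x = x) ->
  inQn n x.
Proof.
move=> l_gt0 dv_n_l Qlx fix_x; have n_gt0 := dvdn_gt0 l_gt0 dv_n_l.
(* [group_num_field_exists] builds Q_l from a group of order l; the additive group of integers mod l
   serves. *)
have card_l : #|[set: 'I_l.-1.+1]| = l by rewrite cardsT card_ord prednK.
have := group_num_field_exists [set: 'I_l.-1.+1]%G.
rewrite card_l => -[L galL [f aut_f [w [prim_w genL] _]]].
have [a _ Dx] := (inQn_adjoin f x prim_w).1 Qlx; subst x.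
have prim_y := prim_expr_div l_gt0 dv_n_l prim_w; set y := w ^+ _ in prim_y.
apply/(inQn_adjoin f _ prim_y); exists a => //.
have galK : galois <<1; y>>%AS {:L}.
  by apply: galoisS galL; rewrite sub1v subvf.
have /galois_fixedField := galK; move <-.
apply/fixedFieldP => [|s sG]; first exact: memvf.
have [u Du] := aut_f s.
apply: (fmorph_inj f); rewrite Du fix_x // => z zn.
have prim_fy : n.-primitive_root (f y) by rewrite fmorph_primitive_root.
have [i ->] := prim_rootP prim_fy zn.
rewrite -rmorphXn -Du /=; congr (f _); apply: (fixed_gal _ sG); rewrite ?subvf //.
exact/rpredX/memv_adjoin.
Qed.

Lemma chinese_eq1_mod n m k : (0 < m)%N -> (k = 1 %[mod gcdn n m])%N ->
  exists2 j, (j = 1 %[mod n])%N & (j = k %[mod m])%N.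
Proof.
move=> m_gt0 Dk.
(* Adding [m * k.+1] does not change k mod the gcd and makes the sum at least 1, so subtracting 1 is
   not truncated. *)
have [t Dt] : exists t, (k + m * k.+1 = 1 + gcdn n m * t)%N.
  have /eqP : (k + m * k.+1 = 1 %[mod gcdn n m])%N.
    by rewrite -modnDmr -modnMml (eqP (dvdn_gcdr n m)) mul0n mod0n addn0.
  rewrite eqn_mod_dvd; last by nia.
  by case/dvdnP=> t Dt; exists t; nia.
have [a _ /dvdnP[b Db]] := Bezoutr n m_gt0.
(* With g the gcd, Bezout gives a n = -g mod m, and [m.-1] is -1 mod m, so the witness is 1 + g t =
   k mod m. *)
exists (1 + n * (m.-1 * a * t))%N; first by rewrite -modnDmr modnMr addn0.
rewrite -(modnMDl (gcdn n m * t)) -[RHS](modnMDl (k.+1 + m.-1 * t * b)).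
congr (_ %% m)%N; case: m m_gt0 Dt Db {Dk} => //= m _; set g := gcdn _ _ => Dt Db.
have E : (n * (m * a * t) + g * (m * t) = m * t * (b * m.+1))%N.
  by rewrite -Db; lia.
lia.
Qed.

(** Let u fix the roots of unity of order dividing the gcd. By the Chinese remainder theorem some
    automorphism v agrees with u on Q_m and is trivial on Q_n, so u x = v x = x. *)
Lemma inQn_gcd n m x : (0 < n)%N -> (0 < m)%N ->
  inQn n x -> inQn m x -> inQn (gcdn n m) x.
Proof.
move=> n_gt0 m_gt0 Qnx Qmx.
apply: (inQn_Galois m_gt0 (dvdn_gcdr n m) Qmx) => u fix_u.
have prim_m := zeta_prim m_gt0; have prim_n := zeta_prim n_gt0.
have [k Dk] : exists k, u (zeta m) = zeta m ^+ k.
  have [|i ->] := (prim_rootP prim_m) (u (zeta m)); last by exists i.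
  by rewrite -rmorphXn prim_expr_order ?rmorph1.
have co_k_m : coprime k m.
  by rewrite -(prim_root_exp_coprime k prim_m) -Dk fmorph_primitive_root.
have k1 : k = 1 %[mod gcdn n m].
  have dv_m := dvdn_gcdr n m.
  have prim_g := prim_expr_div m_gt0 dv_m prim_m.
  apply/eqP; rewrite -(eq_prim_root_expr prim_g) -exprM mulnC exprM -Dk -rmorphXn.
  by rewrite fix_u ?expr1 // prim_expr_order.
have [j jn jm] := chinese_eq1_mod m_gt0 k1.
have co_j : coprime j (lcmn n m).
  apply: (@coprime_dvdr _ (n * m)); first by rewrite dvdn_lcm dvdn_mulr ?dvdn_mull.
  by rewrite coprimeMr -coprime_modl jn coprime_modl coprime1n -coprime_modl jm coprime_modl.
have [v Dv] := Qn_aut_exists co_j.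
have [q Dq] := (inQnE x n_gt0 prim_n).1 Qnx.
have [r Dr] := (inQnE x m_gt0 prim_m).1 Qmx.
have horner_aut (h : {rmorphism algC -> algC}) (s : {poly rat}) z :
    h (map_poly ratr s).[z] = (map_poly ratr s).[h z].
  rewrite -horner_map -map_poly_comp; congr (_.[_]); apply: eq_map_poly => c.
  exact: fmorph_rat.
have zeta_lcm d : (d %| lcmn n m)%N -> d.-primitive_root (zeta d) ->
    v (zeta d) = zeta d ^+ j.
  move=> /dvdnP[e De] prim_d; apply: Dv.
  by rewrite De mulnC exprM (prim_expr_order prim_d) expr1n.
have -> : u x = v x.
  rewrite Dr !horner_aut Dk zeta_lcm ?dvdn_lcmr //; congr (_.[_]).
  by apply/eqP; rewrite (eq_prim_root_expr prim_m) jm.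
rewrite Dq horner_aut zeta_lcm ?dvdn_lcml //; congr (_.[_]).
by apply/eqP; rewrite -{2}[zeta n]expr1 (eq_prim_root_expr prim_n) jn.
Qed.

(** * The Galois group of a cyclotomic field *)

(** In k^p - 1 = (k - 1)(1 + k + ... + k^(p-1)), d divides the first factor; the second is a sum of
    p terms that are 1 mod p. *)
Lemma expn_eq1_mod p d k : prime p -> (p %| d)%N -> (0 < d)%N ->
  (k = 1 %[mod d])%N -> (k ^ p = 1 %[mod d * p])%N.
Proof.
move=> pr_p dv_p_d d_gt0 k1; case: k k1 => [|k] k1.
  move/eqP: k1; rewrite eq_sym eqn_mod_dvd // subn0 dvdn1 => /eqP d1.
  by rewrite d1 dvdn1 in dv_p_d; rewrite (eqP dv_p_d) in pr_p.
apply/eqP; rewrite eqn_mod_dvd ?expn_gt0 // subn1 predn_exp dvdn_mul //.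
  by move/eqP: k1; rewrite eqn_mod_dvd // subn1.
have kp : (k.+1 = 1 %[mod p])%N by rewrite -(modn_dvdm k.+1 dv_p_d) k1 modn_dvdm.
rewrite /dvdn -modn_summ; under eq_bigr => i _.
  rewrite -modnXm kp modnXm exp1n; over.
by rewrite modn_summ sum_nat_const card_ord muln1 modnn.
Qed.

Section GaloisSystem.

Variables (L : splittingFieldType rat) (iota : {rmorphism L -> algC}).
Variable nu : gal_of {:L} -> {rmorphism algC -> algC}.
Hypothesis nuE : forall (s : gal_of {:L}) a, iota (s a) = nu s (iota a).
Variables (l : nat) (w : L).
Hypotheses (prim_w : l.-primitive_root w) (genL : <<1; w>>%VS = fullv).
Hypothesis galL : galois 1 {:L}.

(** A total left inverse of [iota], meaningful only on its image; hence the [in_image] hypotheses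
    below. *)
Definition preimg := sval (num_field_proj iota).

Definition in_image : pred algC := fun z => iota (preimg z) == z.

Definition value_stab (s : seq algC) : {group gal_of {:L}} :=
  'Gal({:L} / <<1 & map preimg s>>)%G.

Lemma iotaK : cancel iota preimg.
Proof. by rewrite /preimg; case: (num_field_proj iota). Qed.

Lemma in_image_iota a : in_image (iota a).
Proof. by rewrite /in_image iotaK. Qed.

Lemma map_pre s : all in_image s -> map iota (map preimg s) = s.
Proof.
by move/allP=> Ls; rewrite -map_comp map_id_in // => z /Ls/eqP.
Qed.

(** Each [nu u] is a separately given extension to [algC], so [nu] is known to be multiplicative
    only on the image of [iota]. *)
Lemma nu1 z : in_image z -> nu 1%g z = z.
Proof. by move/eqP <-; rewrite -nuE gal_id. Qed.

Lemma nuM s t z : in_image z -> nu (s * t)%g z = nu t (nu s z).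
Proof. by move/eqP <-; rewrite -!nuE galM ?memvf. Qed.

Lemma value_stabP s u : all in_image s ->
  reflect {in s, forall z, nu u z = z} (u \in value_stab s).
Proof.
move=> Ls; apply: (iffP idP) => [u_s z sz | fix_u].
  have /eqP Dz := allP Ls z sz; rewrite -Dz -nuE; congr (iota _).
  apply: (fixed_gal _ u_s); first exact: subvf.
  by apply: seqv_sub_adjoin; apply: map_f.
rewrite gal_kHom ?subvf //; apply/kAHomP => a.
have : (<<1 & map preimg s>> <= fixedField [set u])%VS.
  apply/Fadjoin_seqP; split=> [|_ /mapP[z sz ->]]; first exact: sub1v.
  apply/fixedFieldP => [|_ /set1P->]; first exact: memvf.
  apply: (fmorph_inj iota); rewrite nuE.
  by have /eqP-> := allP Ls z sz; apply: fix_u.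
by move/subvP=> sub /sub /mem_fixedFieldP[_]; apply; rewrite inE.
Qed.

Lemma value_stab_cat s t : all in_image (s ++ t) ->
  value_stab (s ++ t) = value_stab s :&: value_stab t :> {set _}.
Proof.
move=> Lst; have:= Lst; rewrite all_cat => /andP[Ls Lt].
apply/setP=> u; rewrite inE; apply/value_stabP/andP => // [fix_u | [us ut] z].
  by split; apply/value_stabP => // z sz; apply: fix_u; rewrite mem_cat sz ?orbT.
by rewrite mem_cat => /orP[]; [apply: value_stabP us z | apply: value_stabP ut z].
Qed.

(** By Galois theory [L : Q(r)] is the order of [value_stab r], so the quotient of degrees over Q is
    an index. *)
Lemma fdeg_value_stab s t :
    all in_image s -> all in_image t -> value_stab t \subset value_stab s ->
  fdeg s t = #|value_stab s : value_stab t|%g.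
Proof.
move=> Ls Lt sub; rewrite -{1}(map_pre Ls) -{1}(map_pre Lt) fdegE.
have dimL r : (\dim {:L} = \dim <<1 & map preimg r>>%VS * #|value_stab r|)%N.
  have galr : galois <<1 & map preimg r>>%AS {:L}.
    by apply: galoisS galL; rewrite sub1v subvf.
  rewrite -(galois_dim galr) mulnC divnK //; apply: field_dimS; exact: subvf.
rewrite -divgS //; have dim_gt0 r : (0 < \dim <<1 & map preimg r>>%VS)%N.
  exact: adim_gt0.
have := dimL s; rewrite (dimL t) => E.
have c_gt0 := cardG_gt0 (value_stab t); have e_gt0 := dim_gt0 s.
have {E} : (\dim <<1 & map preimg t>> * #|value_stab t| =
  \dim <<1 & map preimg s>> * (#|value_stab s| %/ #|value_stab t|) * #|value_stab t|)%N.
  by rewrite E -mulnA divnK ?cardSg.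
by move/eqP; rewrite eqn_pmul2r // => /eqP->; rewrite mulKn.
Qed.

Lemma l_gt0 : (0 < l)%N. Proof. exact: prim_order_gt0 prim_w. Qed.

Lemma zeta_in_image d : (d %| l)%N -> in_image (zeta d).
Proof.
move=> dv_d; have d_gt0 := dvdn_gt0 l_gt0 dv_d.
have prim_iw : l.-primitive_root (iota w) by rewrite fmorph_primitive_root.
have [|i ->] := prim_rootP prim_iw (x := zeta d).
  by have /dvdnP[e ->] := dv_d; rewrite mulnC exprM (prim_expr_order (zeta_prim _)) ?expr1n.
by rewrite -rmorphXn in_image_iota.
Qed.

Definition cyclo_stab d := value_stab [:: zeta d].

Lemma cyclo_stabP d u : (d %| l)%N -> reflect (nu u (zeta d) = zeta d) (u \in cyclo_stab d).
Proof.
move=> dv_d; have Ld : all in_image [:: zeta d] by rewrite /= zeta_in_image.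
apply: (iffP (value_stabP u Ld)) => [-> // | fix_u z]; first by rewrite inE.
by rewrite inE => /eqP->.
Qed.

Lemma cyclo_stab_root d u z : (d %| l)%N -> u \in cyclo_stab d -> z ^+ d = 1 -> nu u z = z.
Proof.
move=> dv_d /(cyclo_stabP _ dv_d) fix_u zd.
have [i ->] := prim_rootP (zeta_prim (dvdn_gt0 l_gt0 dv_d)) zd.
by rewrite rmorphXn /= fix_u.
Qed.

Lemma cyclo_stabS d e : (e %| l)%N -> (d %| e)%N -> cyclo_stab e \subset cyclo_stab d.
Proof.
move=> dv_e dv_de; have dv_d := dvdn_trans dv_de dv_e.
apply/subsetP=> u ue; apply/cyclo_stabP => //; apply: cyclo_stab_root dv_e ue _.
have /dvdnP[k ->] := dv_de; rewrite mulnC exprM.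
by rewrite (prim_expr_order (zeta_prim (dvdn_gt0 l_gt0 dv_d))) expr1n.
Qed.

Lemma gal_root u : exists k, forall z, z ^+ l = 1 -> nu u z = z ^+ k.
Proof.
have prim_z := zeta_prim l_gt0.
have [|k Dk] := prim_rootP prim_z (x := nu u (zeta l)).
  by rewrite -rmorphXn (prim_expr_order prim_z) rmorph1.
exists k => z /(prim_rootP prim_z)[i ->].
by rewrite rmorphXn /= Dk -!exprM mulnC.
Qed.

Lemma gal_root_inj u v :
  (forall z, z ^+ l = 1 -> nu u z = nu v z) -> u = v.
Proof.
move=> eq_uv; apply/eqP/gal_eqP => a _ /=.
have : a \in <<1; w>>%VS by rewrite genL memvf.
case/Fadjoin_polyP=> p Qp ->; rewrite -!horner_map.
have map_p (x : gal_of {:L}) : map_poly x p = p.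
  apply: (@fixedPoly_gal _ L 1%AS {:L}%AS x p _ _ Qp); first exact: sub1v.
  by rewrite gal_kHom ?sub1v // k1HomE ahomWin.
rewrite !map_p; congr (_.[_]); apply: (fmorph_inj iota); rewrite !nuE.
by apply: eq_uv; rewrite -rmorphXn prim_expr_order ?rmorph1.
Qed.

Lemma cyclo_stab_l : cyclo_stab l = 1%G.
Proof.
apply/trivGP/subsetP => u ul; apply/set1P/gal_root_inj => z zl.
rewrite (cyclo_stab_root (dvdnn l) ul zl) nu1 //.
have [i ->] := prim_rootP (zeta_prim l_gt0) zl.
have /eqP <- := zeta_in_image (dvdnn l); rewrite -rmorphXn; exact: in_image_iota.
Qed.

Lemma gal_abelian : abelian [set: gal_of {:L}].
Proof.
apply/centsP=> u _ v _; apply: gal_root_inj => z zl.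
have Lz : in_image z.
  have [i ->] := prim_rootP (zeta_prim l_gt0) zl.
  have /eqP <- := zeta_in_image (dvdnn l); rewrite -rmorphXn; exact: in_image_iota.
have [[i Du] [j Dv]] := (gal_root u, gal_root v).
have ur x k : x ^+ l = 1 -> (x ^+ k) ^+ l = 1 by move=> xl; rewrite exprAC xl expr1n.
by rewrite !nuM // Du // !Dv // ?Du ?ur // -!exprM mulnC.
Qed.

Lemma cyclo_stab_expp p d u : prime p -> (p %| d)%N -> (d * p %| l)%N ->
  u \in cyclo_stab d -> (u ^+ p)%g \in cyclo_stab (d * p).
Proof.
move=> pr_p dv_pd dv_dp.
have dv_d : (d %| l)%N by apply: dvdn_trans dv_dp; apply: dvdn_mulr.
have dp_gt0 := dvdn_gt0 l_gt0 dv_dp; have d_gt0 := dvdn_gt0 l_gt0 dv_d.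
set z := zeta (d * p); have prim_z : (d * p).-primitive_root z := zeta_prim dp_gt0.
have Lz := zeta_in_image dv_dp.
have [k Dk] := gal_root u.
have zl : z ^+ l = 1.
  by have /dvdnP[e ->] := dv_dp; rewrite mulnC exprM (prim_expr_order prim_z) expr1n.
have Dun n : nu (u ^+ n)%g z = z ^+ (k ^ n)%N.
  elim: n => [|n IHn]; first by rewrite expg0 nu1.
  rewrite expgSr nuM // IHn Dk; last by rewrite exprAC zl expr1n.
  by rewrite -exprM expnSr.
move=> ud; apply/cyclo_stabP => //.
rewrite -/z Dun; apply/eqP; rewrite -{2}[z]expr1 (eq_prim_root_expr prim_z).
apply/eqP/expn_eq1_mod => //; apply/eqP.
(* The congruence k = 1 mod d is read off from z^p, a d-th root of unity and so fixed by u. *)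
rewrite -(eqn_pmul2r (prime_gt0 pr_p)) !muln_modl mul1n.
rewrite -(eq_prim_root_expr prim_z) mulnC exprM -Dk; last by rewrite exprAC zl expr1n.
by rewrite (cyclo_stab_root dv_d ud) // -exprM mulnC (prim_expr_order prim_z).
Qed.

(** So Gal(Q_{d p^n}/Q_d) has exponent dividing p^n when p divides d; this is the source of the
    later p-group facts. *)
Lemma cyclo_stab_expp_iter p d n u : prime p -> (p %| d)%N -> (d * p ^ n %| l)%N ->
  u \in cyclo_stab d -> (u ^+ (p ^ n))%g \in cyclo_stab (d * p ^ n).
Proof.
move=> pr_p dv_pd; elim: n => [|n IHn] dv_l ud; first by rewrite muln1.
rewrite expnSr mulnA in dv_l *.
have {}IHn := IHn (dvdn_trans (dvdn_mulr p (dvdnn _)) dv_l) ud.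
by rewrite expgM; apply: cyclo_stab_expp => //; apply: dvdn_mulr.
Qed.

Lemma inQn_cyclo_stab d z : (d %| l)%N -> in_image z ->
  inQn d z <-> forall u, u \in cyclo_stab d -> nu u z = z.
Proof.
move=> dv_d Lz; have Ld := zeta_in_image dv_d.
have prim_y : d.-primitive_root (preimg (zeta d)).
  by rewrite -(fmorph_primitive_root iota) (eqP Ld) zeta_prim ?(dvdn_gt0 l_gt0).
have galK : galois <<1; preimg (zeta d)>>%AS {:L}.
  by apply: galoisS galL; rewrite sub1v subvf.
have DK : <<1 & [:: preimg (zeta d)]>>%VS = <<1; preimg (zeta d)>>%VS.
  exact: adjoin_seq1.
apply: iff_trans (inQn_adjoin iota z prim_y) _; split=> [[a Ka ->] u | fix_z].
  rewrite /cyclo_stab /value_stab /= -nuE => uG; congr (iota _).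
  apply: (fixed_gal _ uG); first exact: subvf.
  by rewrite /= DK.
exists (preimg z); last by rewrite (eqP Lz).
have /galois_fixedField := galK; move <-.
apply/fixedFieldP => [|u uG]; first exact: memvf.
apply: (fmorph_inj iota); rewrite nuE (eqP Lz) fix_z //.
by rewrite /cyclo_stab /value_stab /= DK.
Qed.

(** * Stabilizers and conductors of irreducible characters *)

Section Character.

Variables (gT : finGroupType) (X : {group gT}).
Hypothesis charL : forall (i : Iirr X) x, in_image ('chi_i x).

Lemma cfvals_in_image i : all in_image (cfvals 'chi[X]_i).
Proof. by apply/allP=> _ /mapP[x _ ->]. Qed.

Definition irr_stab i := value_stab (cfvals 'chi[X]_i).

Lemma irr_stabP i u : reflect (aut_Iirr (nu u) i = i) (u \in irr_stab i).
Proof.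
apply: (iffP (value_stabP u (cfvals_in_image i))) => [fix_u | fix_i _ /mapP[x _ ->]].
  apply/irr_inj; rewrite aut_IirrE; apply/cfun_inP => x Xx.
  by rewrite cfunE; apply: fix_u; apply/imageP; exists x.
by rewrite -[in RHS]fix_i aut_IirrE cfunE.
Qed.

Lemma aut_Iirr1 i : aut_Iirr (nu 1%g) i = i :> Iirr X.
Proof.
by apply/irr_inj; rewrite aut_IirrE; apply/cfunP=> x; rewrite cfunE nu1.
Qed.

Lemma aut_IirrM (i : Iirr X) : act_morph (fun i u => aut_Iirr (nu u) i) i.
Proof.
move=> u v; apply/irr_inj; rewrite !aut_IirrE; apply/cfunP=> x.
by rewrite !cfunE nuM.
Qed.

Lemma values_inQn d i : (d %| l)%N ->
  (forall x, inQn d ('chi[X]_i x)) <-> cyclo_stab d \subset irr_stab i.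
Proof.
move=> dv_d; split=> [Qd | /subsetP sub x].
  apply/subsetP=> u ud; apply/value_stabP; first exact: cfvals_in_image.
  by move=> _ /mapP[x _ ->]; apply/(inQn_cyclo_stab dv_d (charL i x)): u ud.
apply/inQn_cyclo_stab => // u /sub /irr_stabP fix_i.
by rewrite -[in RHS]fix_i aut_IirrE cfunE.
Qed.

(** Minimality for the order becomes minimality for divisibility, because [inQn_gcd] lets any d that
    works be replaced by its gcd with c. *)
Lemma conductor_dvd i c : is_conductor 'chi[X]_i c ->
  (c %| l)%N /\ forall d, (d %| l)%N -> (cyclo_stab d \subset irr_stab i) = (c %| d)%N.
Proof.
case=> c_gt0 Qc min_c.
have dv d : (0 < d)%N -> (forall x, inQn d ('chi_i x)) -> (c %| d)%N.
  move=> d_gt0 Qd; apply/gcdn_idPl/eqP; rewrite eqn_leq dvdn_leq ?dvdn_gcdl //=.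
  by apply: min_c => [|x]; [rewrite gcdn_gt0 c_gt0 | apply: inQn_gcd].
have dv_c : (c %| l)%N.
  apply: dv l_gt0 _; apply/values_inQn => //.
  by apply/subsetP => u; rewrite cyclo_stab_l => /set1P->; apply: group1.
split=> // d dv_d; apply/idP/idP => [/values_inQn Qd | dv_cd].
  by apply: dv; rewrite ?(dvdn_gt0 l_gt0) //; apply: Qd.
by apply: subset_trans (cyclo_stabS dv_d dv_cd) _; apply/values_inQn.
Qed.

(** The least divisor of l that works is least among all positive integers: an m that works can be
    replaced by its gcd with l. *)
Lemma conductor_exists i : exists c, is_conductor 'chi[X]_i c.
Proof.
have exP : exists c, (c %| l)%N && (cyclo_stab c \subset irr_stab i).
  exists l; rewrite dvdnn cyclo_stab_l; apply/subsetP=> u /set1P->; exact: group1.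
have [c /andP[dv_c sub] min_c] := ex_minnP exP; exists c.
have Qc := (values_inQn i dv_c).2 sub; have c_gt0 := dvdn_gt0 l_gt0 dv_c.
split=> // m m_gt0 Qm; apply: leq_trans (dvdn_leq m_gt0 (dvdn_gcdl m l)).
apply: min_c; rewrite dvdn_gcdr; apply/values_inQn; first exact: dvdn_gcdr.
move=> x; apply: inQn_gcd l_gt0 _ _ => //.
move: x; apply/values_inQn => //; rewrite cyclo_stab_l.
by apply/subsetP=> u /set1P->; apply: group1.
Qed.

Lemma fdeg_irr p a i : (0 < a)%N -> (p ^ a %| l)%N ->
  fdeg (zeta p :: cfvals 'chi[X]_i) (zeta (p ^ a) :: cfvals 'chi[X]_i)
    = #|(cyclo_stab p :&: irr_stab i)%G : cyclo_stab (p ^ a)|%g.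
Proof.
move=> a_gt0 dv_pa.
have dv_p : (p %| l)%N by apply: dvdn_trans dv_pa; apply: dvdn_exp.
have Ls d : (d %| l)%N -> all in_image (zeta d :: cfvals 'chi[X]_i).
  by move=> dv_d; rewrite /= zeta_in_image // cfvals_in_image.
have DZ d : (d %| l)%N ->
    value_stab (zeta d :: cfvals 'chi[X]_i) = cyclo_stab d :&: irr_stab i :> {set _}.
  by move=> dv_d; rewrite -cat1s value_stab_cat ?cat1s ?Ls.
have sZ := cyclo_stabS dv_pa (dvdn_exp a_gt0 (dvdnn p)).
rewrite (fdeg_value_stab (Ls _ dv_p) (Ls _ dv_pa)) (DZ _ dv_p) (DZ _ dv_pa); last exact: setSI.
(* [#|A : B|] counts the cosets of B met by A, so intersecting B with A does not change it. *)
rewrite -[RHS]indexgI /=; congr #|_ : _|%g.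
by rewrite setIAC (setIidPr sZ).
Qed.

End Character.

End GaloisSystem.

(** * Galois action on characters and Clifford theory *)

Lemma constt_Res_mid (gT : finGroupType) (N M G : {group gT}) i j :
    N \subset M -> M \subset G -> j \in irr_constt ('Res[N, G] 'chi_i) ->
  exists2 k, k \in irr_constt ('Res[M, G] 'chi_i) & j \in irr_constt ('Res[N, M] 'chi_k).
Proof.
move=> sNM sMG ij.
have /exists_inP[k ik kj]:
    [exists k in irr_constt ('Res[M] 'chi_i), j \in irr_constt ('Res[N] 'chi[M]_k)].
  rewrite -negb_forall_in; apply: contraL ij => /forall_inP no_k.
  rewrite irr_consttE negbK -(cfResRes _ sNM sMG).
  rewrite ['Res[M] _]cfun_sum_constt linear_sum cfdot_suml big1 // => k ik.
  by rewrite linearZ /= cfdotZl (eqP (no_k k ik)) mulr0.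
by exists k.
Qed.

Lemma aut_Iirr_constt (gT : finGroupType) (N G : {group gT}) u i j :
    j \in irr_constt ('Res[N, G] 'chi_i) ->
  aut_Iirr u j \in irr_constt ('Res[N, G] 'chi_(aut_Iirr u i)).
Proof.
by rewrite !irr_consttE !aut_IirrE -cfAutRes cfdot_aut_irr fmorph_eq0.
Qed.

Lemma constt_Res_conj (gT : finGroupType) (N G : {group gT}) i j k :
    (N <| G)%g -> j \in irr_constt ('Res[N, G] 'chi_i) ->
  (k \in irr_constt ('Res[N, G] 'chi_i)) = (k \in cfclass_Iirr G j).
Proof.
move=> nsNG ij; rewrite cfclass_IirrE irr_consttE.
rewrite (Clifford_Res_sum_cfclass nsNG ij) cfdotZl reindex_cfclass // cfdot_suml.
rewrite mulf_eq0 negb_or -irr_consttE ij /=.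
have [jk | not_jk] := boolP ('chi_k \in _).
  rewrite (bigD1 k) //= cfnorm_irr big1 ?addr0 ?oner_eq0 // => m /andP[_ ne_mk].
  by rewrite cfdot_irr (negbTE ne_mk).
rewrite big1 ?eqxx // => m jm; rewrite cfdot_irr.
by case: eqP jm not_jk => // -> ->.
Qed.

(** Climbs a chain from N to G with normal steps of prime index. That each index divides [#|G : N|]
    keeps it different from p in the applications. *)
Lemma solvable_quotient_ind (gT : finGroupType) (N G : {group gT}) (P : {group gT} -> Prop) :
    (N <| G)%g -> solvable (G / N)%g -> P N ->
    (forall M K : {group gT}, (N <| K)%g -> N \subset M -> K \subset G -> (M <| K)%g ->
      prime #|K : M|%g -> (#|K : M|%g %| #|G : N|%g)%N -> P M -> P K) ->
  P G.
Proof.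
move=> nsNG solGN PN step; have nNG := normal_norm nsNG.
suff IH n (K : {group gT}) : N \subset K -> K \subset G -> (#|K| < n)%N -> P K.
  exact: (IH #|G|.+1 G (normal_sub nsNG)).
elim: n K => // n IHn K sNK sKG; rewrite ltnS => le_Kn.
have nsNK : (N <| K)%g := normalS sNK sKG nsNG.
have [KN1 | ntKN] := eqVneq (K / N)%g 1%g.
  suff -> : K = N by [].
  by apply/val_inj/eqP; rewrite eqEsubset sNK -quotient_sub1 ?KN1 ?normal_norm ?subxx.
have solKN : solvable (K / N)%g := solvableS (quotientS N sKG) solGN.
have [Mbar nsM] := sol_prime_factor_exists solKN ntKN.
have [M defM sNM nsMK] := inv_quotientN nsNK nsM => pr_M.
have nMN : (N <| M)%g := normalS sNM (normal_sub nsMK) nsNK.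
have pr : prime #|K : M|%g.
  by rewrite defM index_quotient_eq ?(subset_trans (subsetIr _ _)) ?normal_norm ?normal_sub in pr_M.
apply: (step M K) => //.
  rewrite -(Lagrange_index sKG sNK) -(Lagrange_index (normal_sub nsMK) sNM).
  by rewrite dvdn_mull ?dvdn_mulr.
apply: IHn => //; first exact: subset_trans (normal_sub nsMK) sKG.
apply: leq_trans le_Kn; rewrite -(Lagrange (normal_sub nsMK)) ltn_Pmulr ?prime_gt1 //.
Qed.

(** * Fixed points of p-groups of field automorphisms *)

Section IrrAction.

Variables (gamT : finGroupType) (nu : gamT -> {rmorphism algC -> algC}).

(** The two conditions from which [TotalAction] builds a group action; [nu] itself is not assumed to
    be a homomorphism. *)
Definition irr_action (gT : finGroupType) (H : {group gT}) :=
  (forall i : Iirr H, aut_Iirr (nu 1%g) i = i) /\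
  (forall i : Iirr H, act_morph (fun i u => aut_Iirr (nu u) i) i).

Lemma pgroup_fixes_irr (gT : finGroupType) (H : {group gT}) (p : nat) (P : {group gamT})
    (S : {set Iirr H}) :
    irr_action H -> (p.-group P)%g -> ~~ (p %| #|S|)%N ->
    (forall u i, u \in P -> i \in S -> aut_Iirr (nu u) i \in S) ->
  exists2 i, i \in S & forall u, u \in P -> aut_Iirr (nu u) i = i.
Proof.
move=> [to1 toM] pP p'S actsPS; pose to := TotalAction to1 toM.
have actsS : [acts P, on S | to].
  apply/subsetP=> u Pu; rewrite !inE /=.
  by apply/subsetP=> i Si; rewrite inE /=; apply: actsPS.
have := pgroup_fix_mod pP actsS.
have [-> | [i]] := set_0Vmem 'Fix_(S | to)(P)%g.
  by rewrite cards0 => /eqP; rewrite mod0n -/(dvdn _ _) (negbTE p'S).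
by case/setIP=> Si /afixP fix_i _; exists i.
Qed.

Lemma pgroup_fixes_constt (gT : finGroupType) (N G : {group gT}) (p : nat) (P : {group gamT}) i j :
    irr_action N -> (N <| G)%g -> prime p -> ~~ (p %| #|G : N|%g)%N -> (p.-group P)%g ->
    j \in irr_constt ('Res[N, G] 'chi_i) ->
    (forall u, u \in P -> aut_Iirr (nu u) i = i) ->
  forall u, u \in P -> aut_Iirr (nu u) j = j.
Proof.
move=> actN nsNG pr_p p'GN pP ij fix_i.
have [|u k Pu jk|k jk fix_k u Pu] := pgroup_fixes_irr (S := cfclass_Iirr G j) actN pP.
(* The number of constituents is the index of the inertia group, which contains N, so it divides
   [#|G : N|]. *)
- apply: contra p'GN => /dvdn_trans; apply; rewrite card_cfclass_Iirr //.
  by apply: indexgS; apply: sub_Inertia (normal_sub nsNG).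
- rewrite -(constt_Res_conj _ nsNG ij) -(fix_i u Pu) aut_Iirr_constt //.
  by rewrite (constt_Res_conj _ nsNG ij).
have /imsetP[y Gy Dk] := jk.
apply: (@conjg_Iirr_inj _ _ y); rewrite -[RHS]Dk -(fix_k u Pu) Dk.
by apply/irr_inj; rewrite conjg_IirrE !aut_IirrE conjg_IirrE cfAutConjg.
Qed.

Lemma prime_index_abelian_quotient (gT : finGroupType) (N G : {group gT}) :
  (N <| G)%g -> prime #|G : N|%g -> abelian (G / N)%g.
Proof.
move=> nsNG pr_q; apply/cyclic_abelian/prime_cyclic.
by rewrite card_quotient ?normal_norm.
Qed.

(** The inertia group lies between N and G, so it is one of them; if it is N, the Clifford
    correspondence is induction from N. *)
Lemma prime_index_invariant_or_induced (gT : finGroupType) (N G : {group gT}) j :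
    (N <| G)%g -> prime #|G : N|%g ->
  G \subset 'I['chi[N]_j]%g \/ 'Ind[G] 'chi_j \in irr G.
Proof.
move=> nsNG pr_q; have sNG := normal_sub nsNG.
have [|not_invj] := boolP (G \subset 'I['chi_j])%g; [by left | right].
have defI : 'I_G['chi_j]%G = N.
  apply/val_inj => /=.
  have sNT : N \subset 'I_G['chi_j]%g by apply: sub_Inertia.
  have Dq := Lagrange_index (Inertia_sub G 'chi_j) sNT.
  have /primeP[_ /(_ #|G : 'I_G['chi_j]|%g)] := pr_q.
  rewrite -Dq dvdn_mulr // => /(_ isT) /orP[/eqP GT1 | /eqP GTq].
    case/negP: not_invj; apply: subset_trans (subsetIr G _).
    by rewrite -indexg_eq1 GT1.
  apply/eqP; rewrite eqEsubset sNT andbT -indexg_eq1.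
  by rewrite -(eqn_pmul2l (indexg_gt0 G 'I_G['chi_j]%g)) muln1 -GTq.
have [irrI _ _ _ _] := constt_Inertia_bijection j nsNG.
rewrite defI in irrI; apply: irrI.
by rewrite cfInd_id constt_irr inE.
Qed.

(** By Gallagher, the constituents of the induced character are the products of one extension with
    the q linear characters of G/N. A p-group permuting these q characters fixes one, as p does not
    divide q. *)
Lemma pgroup_fixes_extension (gT : finGroupType) (N G : {group gT}) (p : nat)
    (P : {group gamT}) j :
    irr_action G -> (N <| G)%g -> prime p -> prime #|G : N|%g -> p != #|G : N|%g ->
    (p.-group P)%g -> (forall u, u \in P -> aut_Iirr (nu u) j = j) ->
    G \subset 'I['chi[N]_j]%g ->
  exists2 i, 'Res[N, G] 'chi_i = 'chi_j & forall u, u \in P -> aut_Iirr (nu u) i = i.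
Proof.
move=> actG nsNG pr_p pr_q ne_pq pP fix_j invj.
have abGN := prime_index_abelian_quotient nsNG pr_q.
have [t tj] := prime_invariant_irr_extendible nsNG (erefl _) pr_q invj.
have [irr_mul inj_mul constt_mul _] := constt_Ind_ext nsNG tj.
have [|u i Pu|i Si fix_i] :=
  pgroup_fixes_irr (S := [set i in irr_constt ('Ind[G] 'chi_j)]) actG pP.
- rewrite cardsE (eq_card constt_mul) card_codom // card_ord NirrE.
  have /eqP -> : #|classes (G / N)%g| == #|(G / N)%g|.
    by rewrite -card_classes_abelian.
  by rewrite card_quotient ?normal_norm // dvdn_prime2.
- by rewrite !in_set !constt_Ind_Res => /aut_Iirr_constt-/(_ (nu u)); rewrite fix_j.
exists i => //; rewrite in_set in Si.
have /codomP[b ->] : i \in codom (@mul_mod_Iirr _ G N t) by rewrite -constt_mul.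
rewrite cfIirrE // rmorphM /= tj mod_IirrE // cfRes_sub_ker ?cfker_mod // cfMod1.
suff /lin_char1-> : 'chi_b \is a linear_char by rewrite scale1r mul1r.
exact/char_abelianP.
Qed.

(** The ratio e is 1 when ['chi_j] extends and the index when it induces irreducibly; its
    coprimality to p later lets divisibility descend. *)
Lemma pgroup_fixes_over (gT : finGroupType) (N G : {group gT}) (p : nat)
    (P : {group gamT}) j :
    irr_action G -> (N <| G)%g -> prime p -> prime #|G : N|%g -> p != #|G : N|%g ->
    (p.-group P)%g -> (forall u, u \in P -> aut_Iirr (nu u) j = j) ->
  exists i, [/\ j \in irr_constt ('Res[N, G] 'chi_i),
    forall u, u \in P -> aut_Iirr (nu u) i = i
    & exists2 e, coprime p e & 'chi_i 1%g = e%:R * 'chi_j 1%g].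
Proof.
move=> actG nsNG pr_p pr_q ne_pq pP fix_j.
have [invj | irrInd] := prime_index_invariant_or_induced j nsNG pr_q.
  have [i ij fix_i] := pgroup_fixes_extension actG nsNG pr_p pr_q ne_pq pP fix_j invj.
  exists i; split=> //; first by rewrite ij constt_irr inE.
  by exists 1%N; rewrite ?coprimen1 // mul1r -ij cfRes1.
have /irrP[i Di] := irrInd; exists i; split.
- by rewrite -constt_Ind_Res Di constt_irr inE.
- by move=> u Pu; apply/irr_inj; rewrite aut_IirrE -Di cfAutInd -aut_IirrE fix_j.
exists #|G : N|%g; first by rewrite prime_coprime // dvdn_prime2.
by rewrite -Di cfInd1 ?normal_sub.
Qed.

(** In the invariant case ['chi_i] is a fixed extension times a linear character of G/N, whose
    values are roots of unity fixed by [nu u]; otherwise it is induced from ['chi_j]. *)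
Lemma pelt_fixes_over_prime (gT : finGroupType) (N G : {group gT}) (p : nat) u i j :
    irr_action N -> irr_action G -> (N <| G)%g ->
    prime p -> prime #|G : N|%g -> p != #|G : N|%g -> (p.-elt u)%g ->
    (forall z, z ^+ #|G : N|%g = 1 -> nu u z = z) ->
    j \in irr_constt ('Res[N, G] 'chi_i) ->
  aut_Iirr (nu u) j = j -> aut_Iirr (nu u) i = i.
Proof.
move=> [to1 toM] actG nsNG pr_p pr_q ne_pq p_u fix_z ij fix_j.
have fix_cyc v : v \in <[u]>%g -> aut_Iirr (nu v) j = j.
  case/cycleP=> n ->; elim: n => [|n IHn]; first by rewrite expg0 to1.
  by rewrite expgSr toM IHn.
have [invj | irrInd] := prime_index_invariant_or_induced j nsNG pr_q.
  have [k kj /(_ u (cycle_id u)) fix_k] :=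
    pgroup_fixes_extension actG nsNG pr_p pr_q ne_pq p_u fix_cyc invj.
  have [irr_mul _ constt_mul _] := constt_Ind_ext nsNG kj.
  have /codomP[b ->] : i \in codom (@mul_mod_Iirr _ G N k).
    by rewrite -constt_mul constt_Ind_Res.
  apply/irr_inj; rewrite aut_IirrE cfIirrE // rmorphM /= -(aut_IirrE _ k) fix_k.
  congr (_ * _); apply/cfun_inP => x Gx; rewrite cfunE mod_IirrE // cfModE //.
  apply: fix_z; have lin_b : 'chi_b \is a linear_char.
    exact/char_abelianP/prime_index_abelian_quotient.
  have Gx' : coset N x \in (G / N)%g by rewrite mem_quotient.
  have /dvdnP[m ->] : (#[coset N x]%g %| #|G : N|%g)%N.
    by rewrite -card_quotient ?normal_norm // order_dvdG.
  by rewrite mulnC exprM (lin_char_unity_root lin_b Gx') expr1n.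
have /irrP[k Dk] := irrInd.
have -> : i = k.
  by move: ij; rewrite -constt_Ind_Res Dk constt_irr inE => /eqP.
by apply/irr_inj; rewrite aut_IirrE -Dk cfAutInd -aut_IirrE fix_j.
Qed.

Lemma pelt_fixes_over_solvable (gT : finGroupType) (N G : {group gT}) (p : nat) u i j :
    (forall H : {group gT}, H \subset G -> irr_action H) ->
    (N <| G)%g -> solvable (G / N)%g ->
    prime p -> ~~ (p %| #|G : N|%g)%N -> (p.-elt u)%g ->
    (forall z, z ^+ #|G : N|%g = 1 -> nu u z = z) ->
    j \in irr_constt ('Res[N, G] 'chi_i) ->
  aut_Iirr (nu u) j = j -> aut_Iirr (nu u) i = i.
Proof.
move=> actG nsNG solGN pr_p p'GN p_u fix_z ij fix_j.
pose P (K : {group gT}) := forall i : Iirr K, j \in irr_constt ('Res[N] 'chi_i) ->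
  aut_Iirr (nu u) i = i.
suff: P G by apply.
apply: (solvable_quotient_ind nsNG solGN) => [k | M K nsNK sNM sKG nsMK pr_q dv_q PM k kj].
  by rewrite cfRes_id constt_irr inE => /eqP <-.
have sMK := normal_sub nsMK.
have [m km mj] := constt_Res_mid sNM sMK kj.
apply: (pelt_fixes_over_prime _ _ nsMK pr_p pr_q _ p_u _ km (PM m mj)).
- exact/actG/(subset_trans sMK).
- exact: actG.
- by apply: contraNneq p'GN => ->.
move=> z zq; apply: fix_z.
by have /dvdnP[e ->] := dv_q; rewrite mulnC exprM zq expr1n.
Qed.

(* A value at x is seen on N<x>, whose quotient by N is cyclic. *)
Lemma pelt_fixes_over (gT : finGroupType) (N G : {group gT}) (p : nat) u i j :
    (forall H : {group gT}, H \subset G -> irr_action H) ->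
    (N <| G)%g -> prime p -> ~~ (p %| #|G : N|%g)%N -> (p.-elt u)%g ->
    (forall z, z ^+ #|G : N|%g = 1 -> nu u z = z) ->
    j \in irr_constt ('Res[N, G] 'chi_i) ->
  aut_Iirr (nu u) j = j -> aut_Iirr (nu u) i = i.
Proof.
move=> actG nsNG pr_p p'GN p_u fix_z ij fix_j.
have fix_constt k : k \in irr_constt ('Res[N] 'chi_i) -> aut_Iirr (nu u) k = k.
  rewrite (constt_Res_conj _ nsNG ij) => /imsetP[y Gy ->].
  by apply/irr_inj; rewrite aut_IirrE conjg_IirrE cfAutConjg -aut_IirrE fix_j.
apply/irr_inj; rewrite aut_IirrE; apply/cfun_inP => x Gx.
pose K := (N <*> <[x]>)%G; have sNG := normal_sub nsNG.
have sxG : <[x]>%g \subset G by rewrite cycle_subG.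
have sNK : N \subset K by apply: joing_subl.
have sKG : K \subset G by rewrite join_subG sNG.
have nsNK : (N <| K)%g := normalS sNK sKG nsNG.
have Kx : x \in K by rewrite (subsetP (joing_subr N _)) ?cycle_id.
have solK : solvable (K / N)%g.
  apply/abelian_sol/cyclic_abelian; rewrite /= quotientYidl ?quotient_cyclic ?cycle_cyclic //.
  exact: subset_trans sxG (normal_norm nsNG).
have dvK : (#|K : N|%g %| #|G : N|%g)%N.
  by rewrite -(Lagrange_index sKG sNK) dvdn_mull.
suff : cfAut (nu u) ('Res[K] 'chi_i) = 'Res[K] 'chi_i.
  by move/cfunP/(_ x); rewrite !cfunE !cfResE.
rewrite ['Res[K] _]cfun_sum_constt rmorph_sum /=; apply: eq_bigr => k ik.
(* The constituent m below k may differ from j; this is why all constituents of the restriction to N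
   were shown fixed. *)
have [m km] := constt_cfRes_irr N k.
have im : m \in irr_constt ('Res[N] 'chi_i).
  rewrite -(cfResRes _ sNK sKG).
  by apply: (constt_Res_trans (j := k)) => //; apply: cfRes_char; apply: irr_char.
have /natrP[e ->] : '['Res[K] 'chi_i, 'chi_k] \in Num.nat.
  by rewrite Cnat_cfdot_char ?cfRes_char ?irr_char.
rewrite cfAutZ_nat -aut_IirrE; congr (_ *: 'chi_ _).
apply: (pelt_fixes_over_solvable _ nsNK solK pr_p _ p_u _ km (fix_constt m im)).
- by move=> H sHK; apply/actG/(subset_trans sHK).
- by apply: contra p'GN => /dvdn_trans; apply.
move=> z zq; apply: fix_z.
by have /dvdnP[e' ->] := dvK; rewrite mulnC exprM zq expr1n.
Qed.

End IrrAction.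

(** * Transfer between a group and a normal subgroup *)

(* [dvdC_nat] is stated through a coercion of [nat] into divisors and does not
   rewrite terms written with [%:R]. *)
Lemma dvdC_natr (d n : nat) : ((d%:R : algC) %| (n%:R : algC))%C = (d %| n)%N.
Proof. exact: dvdC_nat. Qed.

Lemma quotient_pgroup (gT : finGroupType) (p n : nat) (X A : {group gT}) :
    prime p -> X \subset 'N(A)%g -> (forall x, x \in X -> (x ^+ (p ^ n))%g \in A) ->
  (p.-group (X / A))%g.
Proof.
move=> pr_p nAX expX; rewrite -pnat_exponent.
have dv_pn : (exponent (X / A)%g %| p ^ n)%N.
  apply/exponentP=> _ /morphimP[x Nx Xx ->].
  by rewrite -morphX //= coset_id ?expX.
by apply: pnat_dvd dv_pn _; rewrite pnatX pnat_id.
Qed.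

(** Since X/A is a p-group, the image of P is all of it, and that image lies in Y/A. *)
Lemma Sylow_index_dvd (gT : finGroupType) (p : nat) (P X Y A : {group gT}) :
    X \subset 'N(A)%g -> Y \subset 'N(A)%g -> (p.-group (X / A))%g ->
    (p.-Sylow(X) P)%g -> P \subset Y ->
  (#|X : A|%g %| #|Y : A|%g)%N.
Proof.
move=> nAX nAY pXA sylP sPY; rewrite -!card_quotient //.
have sPX := pHall_sub sylP.
have /pHall_id <- := quotient_pHall (subset_trans sPX nAX) sylP; last by [].
exact/cardSg/quotientS.
Qed.

(** Expresses a bound on the p-part of a conductor as containment of the field of values in a single
    cyclotomic field. *)
Lemma dvdn_p_part (p c e l : nat) : prime p -> (0 < l)%N -> (c %| l)%N ->
  (c %| p ^ e * l`_p^')%N = (logn p c <= e)%N.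
Proof.
move=> pr_p l_gt0 dv_c; have c_gt0 := dvdn_gt0 l_gt0 dv_c.
have m_gt0 := part_gt0 p^' l; have pe_gt0 : (0 < p ^ e)%N by rewrite expn_gt0 prime_gt0.
apply/idP/idP => [/(dvdn_leq_log p) | le_e].
  rewrite muln_gt0 pe_gt0 => /(_ m_gt0); rewrite lognM // pfactorK //.
  by rewrite (@logn_coprime p l`_p^') ?addn0 // prime_coprime // -p'natE ?part_pnat.
rewrite -(partnC p c_gt0) dvdn_mul //; last exact: partn_dvd.
by rewrite p_part dvdn_exp2l.
Qed.

Section Transfer.

Variables (L : splittingFieldType rat) (iota : {rmorphism L -> algC}).
Variable nu : gal_of {:L} -> {rmorphism algC -> algC}.
Hypothesis nuE : forall (s : gal_of {:L}) a, iota (s a) = nu s (iota a).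
Variables (gT : finGroupType) (G : {group gT}) (w : L).
Hypotheses (prim_w : #|G|.-primitive_root w) (genL : <<1; w>>%VS = fullv).
Hypothesis galL : galois 1 {:L}.
Hypothesis charL : forall H : {group gT}, H \subset G ->
  forall (i : Iirr H) x, in_image iota ('chi_i x).
Variable p : nat.
Hypothesis pr_p : prime p.

Local Notation Z := (cyclo_stab iota).
Local Notation I := (irr_stab iota).
Local Notation l := #|G|.
Local Notation m := (l`_p^')%N.

(** By [fdeg_irr], the degree in [star_prop] as a number of cosets; [Z (p ^ a)] need not lie in
    [I i]. *)
Definition stardeg (H : {group gT}) (i : Iirr H) a := #|(Z p :&: I i)%G : Z (p ^ a)|%g.

Lemma nu_irr_action (H : {group gT}) : H \subset G -> irr_action nu H.
Proof.
move=> sHG; split; first by move=> i; apply: (aut_Iirr1 nuE (charL sHG)).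
by move=> i; apply: (aut_IirrM nuE (charL sHG)).
Qed.

Lemma irr_stab_fixP (H : {group gT}) (i : Iirr H) (P : {group gal_of {:L}}) :
  H \subset G -> reflect (forall u, u \in P -> aut_Iirr (nu u) i = i) (P \subset I i).
Proof.
move=> sHG; apply: (iffP subsetP) => [sub u Pu | fix_i u Pu].
  by apply/(irr_stabP nuE (charL sHG)); apply: sub.
by apply/(irr_stabP nuE (charL sHG)); apply: fix_i.
Qed.

Lemma gal_normal (X A : {group gal_of {:L}}) : X \subset 'N(A)%g.
Proof.
apply: subset_trans (cent_sub _).
exact: sub_abelian_cent2 (gal_abelian nuE prim_w genL) (subsetT _) (subsetT _).
Qed.

Lemma Z_quotient_pgroup a (X : {group gal_of {:L}}) :
  (0 < a)%N -> (p ^ a %| l)%N -> X \subset Z p -> (p.-group (X / Z (p ^ a)))%g.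
Proof.
move=> a_gt0 dv_pa sXZ; have Da : (p * p ^ a.-1 = p ^ a)%N by rewrite -expnS prednK.
apply: (quotient_pgroup (n := a.-1) pr_p (gal_normal _ _)) => u Xu.
by rewrite -Da; apply: (cyclo_stab_expp_iter nuE prim_w) => //; rewrite ?Da ?(subsetP sXZ).
Qed.

Lemma stardeg_pnat (H : {group gT}) (i : Iirr H) a :
  (0 < a)%N -> (p ^ a %| l)%N -> (p.-nat (stardeg i a))%N.
Proof.
move=> a_gt0 dv_pa; rewrite /stardeg -card_quotient ?gal_normal //.
exact: (Z_quotient_pgroup a_gt0 dv_pa (subsetIl _ _)).
Qed.

(** Both degrees are orders of quotients by [Z (p ^ a)], the first a p-group, so a Sylow p-subgroup
    suffices to compare them. *)
Lemma stardeg_dvd (P : {group gal_of {:L}}) (H K : {group gT}) (i : Iirr H) (j : Iirr K) a :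
    (0 < a)%N -> (p ^ a %| l)%N -> (p.-Sylow(Z p :&: I i) P)%g -> P \subset I j ->
  (stardeg i a %| stardeg j a)%N.
Proof.
move=> a_gt0 dv_pa sylP sPI.
apply: (Sylow_index_dvd (gal_normal _ _) (gal_normal _ _) _ sylP).
  exact: (Z_quotient_pgroup a_gt0 dv_pa (subsetIl _ _)).
by rewrite subsetI sPI (subset_trans (pHall_sub sylP)) ?subsetIl.
Qed.

(** Here p m is l with its p-part cut down to p, so a power of u with exponent a power of p lies in
    [Z l], which is trivial. *)
Lemma pelt_Z u : (p * m %| l)%N -> u \in Z (p * m) -> (p.-elt u)%g.
Proof.
move=> dv_pm uZ; have p_dv_l : (p %| l)%N := dvdn_trans (dvdn_mulr m (dvdnn p)) dv_pm.
have b_gt0 : (0 < logn p l)%N by rewrite logn_gt0 mem_primes pr_p cardG_gt0.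
have Dl : (p * m * p ^ (logn p l).-1 = l)%N.
  by rewrite mulnAC -expnS prednK // -p_part partnC.
have := cyclo_stab_expp_iter nuE prim_w (n := (logn p l).-1) pr_p (dvdn_mulr m (dvdnn p)) _ uZ.
rewrite Dl (cyclo_stab_l nuE prim_w genL) => /(_ (dvdnn _))/set1P/eqP; rewrite -order_dvdn => dv_u.
by apply: pnat_dvd dv_u _; rewrite pnatX pnat_id.
Qed.

Section Linked.

Variables (N K : {group gT}) (i : Iirr K) (j : Iirr N).
Hypotheses (sKG : K \subset G) (nsNK : (N <| K)%g) (p'KN : ~~ (p %| #|K : N|%g)%N).
Hypothesis ij : j \in irr_constt ('Res[N, K] 'chi_i).

Let sNG : N \subset G. Proof. exact: subset_trans (normal_sub nsNK) sKG. Qed.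

Lemma pgroup_fixes_below (P : {group gal_of {:L}}) :
  (p.-group P)%g -> P \subset I i -> P \subset I j.
Proof.
move=> pP /(irr_stab_fixP i P sKG) fix_i; apply/(irr_stab_fixP j P sNG).
exact: (pgroup_fixes_constt (nu_irr_action sNG) nsNK pr_p p'KN pP ij).
Qed.

Lemma pelt_fixes_iff u : (p * m %| l)%N -> u \in Z (p * m) ->
  (u \in I i) = (u \in I j).
Proof.
move=> dv_pm uZ; have p_u := pelt_Z dv_pm uZ.
apply/idP/idP => [ui | /(irr_stabP nuE (charL sNG)) fix_j].
  by rewrite -cycle_subG; apply: pgroup_fixes_below; rewrite ?cycle_subG.
apply/(irr_stabP nuE (charL sKG)).
apply: (pelt_fixes_over _ nsNK pr_p p'KN p_u _ ij fix_j) => [H sHK | z zq].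
  exact/nu_irr_action/(subset_trans sHK).
have dv_m : (m %| l)%N by apply: dvdn_part.
have um : u \in Z m.
  by apply: subsetP uZ; apply: (cyclo_stabS nuE prim_w) => //; apply: dvdn_mull.
apply: (cyclo_stab_root nuE prim_w dv_m um).
(* The index divides l and is prime to p, so it divides m, and u fixes the roots of unity of that
   order. *)
have dv_q : (#|K : N|%g %| m)%N.
  rewrite -(@part_pnat_id p^' #|K : N|%g); last by rewrite p'natE.
  apply: partn_dvd; rewrite ?cardG_gt0 //.
  by apply: dvdn_trans (dvdn_indexg K N) (cardSg sKG).
by have /dvdnP[e ->] := dv_q; rewrite mulnC exprM zq expr1n.
Qed.

(** Each side says that [Z (p ^ e * m)] lies in the stabilizer. As e is positive, this group lies in
    [Z (p * m)], on which the two stabilizers agree. *)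
Lemma logn_conductor_le ci cj e : is_conductor 'chi_i ci -> is_conductor 'chi_j cj ->
  (0 < e <= logn p l)%N -> (logn p ci <= e)%N = (logn p cj <= e)%N.
Proof.
move=> /(conductor_dvd nuE prim_w genL galL (charL sKG))[dv_ci cond_i].
move=> /(conductor_dvd nuE prim_w genL galL (charL sNG))[dv_cj cond_j].
case/andP=> e_gt0 le_e; have dv_d : (p ^ e * m %| l)%N.
  by rewrite -{2}(partnC p (cardG_gt0 G)) dvdn_pmul2r ?part_gt0 // p_part dvdn_exp2l.
have dv_pm_d : (p * m %| p ^ e * m)%N by rewrite dvdn_mul ?dvdn_exp.
have dv_pm := dvdn_trans dv_pm_d dv_d.
rewrite -!(dvdn_p_part _ pr_p (cardG_gt0 G)) // -cond_i // -cond_j //.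
have eq_I u : u \in Z (p ^ e * m) -> (u \in I i) = (u \in I j).
  by move/(subsetP (cyclo_stabS nuE prim_w dv_d dv_pm_d)); apply: pelt_fixes_iff.
by apply/subsetP/subsetP=> sub u uZ; [rewrite -eq_I | rewrite eq_I] => //; apply: sub.
Qed.

End Linked.

Lemma logn_conductor_leG (H : {group gT}) (i : Iirr H) c : H \subset G ->
  is_conductor 'chi_i c -> (logn p c <= logn p l)%N /\ (p ^ logn p c %| l)%N.
Proof.
move=> sHG /(conductor_dvd nuE prim_w genL galL (charL sHG))[dv_c _]; split.
  exact: dvdn_leq_log.
exact: dvdn_trans (pfactor_dvdnn p c) dv_c.
Qed.

(** For a = 1 the degree is 1 and the condition is void, which removes the range where the two
    conductors may have different p-parts. *)
Lemma star_propE (H : {group gT}) : H \subset G ->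
  star_prop p H <-> (forall (i : Iirr H) c, is_conductor 'chi_i c ->
    (2 <= logn p c)%N -> ((stardeg i (logn p c))%:R %| 'chi_i 1%g)%C).
Proof.
move=> sHG; split=> star i c cond_c => [a_ge2 | a a_gt0].
  have [_ dv_pa] := logn_conductor_leG sHG cond_c.
  have := star i c cond_c (ltnW a_ge2).
  by rewrite (fdeg_irr nuE prim_w galL (charL sHG)) //; apply: ltnW.
have [_ dv_pa] := logn_conductor_leG sHG cond_c.
rewrite (fdeg_irr nuE prim_w galL (charL sHG)) //.
have [a_ge2 | a_lt2] := leqP 2 a; first exact: star.
have -> : a = 1%N by apply/eqP; rewrite eqn_leq a_gt0 -ltnS a_lt2.
have /eqP -> : #|(Z p :&: I i)%G : Z (p ^ 1)|%g == 1%N by rewrite indexg_eq1 expn1 subsetIl.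
by rewrite (irr1_degree i) dvdC_natr dvd1n.
Qed.

Lemma logn_conductor_eq (N K : {group gT}) (i : Iirr K) (j : Iirr N) ci cj :
    K \subset G -> (N <| K)%g -> ~~ (p %| #|K : N|%g)%N ->
    j \in irr_constt ('Res[N, K] 'chi_i) ->
    is_conductor 'chi_i ci -> is_conductor 'chi_j cj ->
    (2 <= logn p ci)%N || (2 <= logn p cj)%N ->
  logn p ci = logn p cj.
Proof.
move=> sKG nsNK p'KN ij cond_i cond_j ge2.
have [le_i _] := logn_conductor_leG sKG cond_i.
have [le_j _] := logn_conductor_leG (subset_trans (normal_sub nsNK) sKG) cond_j.
have le_ij := logn_conductor_le sKG nsNK p'KN ij cond_i cond_j.
have := le_ij (logn p ci); have := le_ij (logn p cj).
(* If the exponents differed, the larger would be at least 2, and the threshold just below it would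
   separate them. *)
have := le_ij (logn p ci).-1; have := le_ij (logn p cj).-1.
lia.
Qed.

(** For any constituent theta of chi_N, the degree for chi divides that for theta, hence theta(1),
    hence chi(1). *)
Lemma star_prop_over (N : {group gT}) :
  (N <| G)%g -> ~~ (p %| #|G : N|%g)%N -> star_prop p N -> star_prop p G.
Proof.
move=> nsNG p'GN; have sNG := normal_sub nsNG.
move=> /(star_propE sNG) starN.
apply/(star_propE (subxx G)) => i c cond_c a_ge2.
have [j ij] := constt_cfRes_irr N i.
have [cj cond_cj] := conductor_exists nuE prim_w genL galL (charL sNG) j.
have Da : logn p c = logn p cj.
  by apply: logn_conductor_eq (subxx G) nsNG p'GN ij cond_c cond_cj _; rewrite a_ge2.
have [e ->] := dvdn_constt_Res1_irr1 nsNG ij.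
have [_ dv_pa] := logn_conductor_leG sNG cond_cj.
have [P sylP] := Sylow_exists p (Z p :&: I i).
have sPI : P \subset I i := subset_trans (pHall_sub sylP) (subsetIr _ _).
have := starN j cj cond_cj; rewrite -Da a_ge2 => /(_ isT) dv_j.
apply: (@dvdC_trans _ (stardeg j (logn p c))%:R).
  rewrite dvdC_natr; apply: (stardeg_dvd _ _ sylP _); rewrite ?Da //.
    by rewrite -Da (ltnW a_ge2).
  exact: (pgroup_fixes_below (subxx G) nsNG p'GN ij (pHall_pgroup sylP) sPI).
rewrite (irr1_degree j) dvdC_natr in dv_j; rewrite irr1_degree -natrM dvdC_natr.
exact: dvdn_mull.
Qed.

(** Take chi over theta fixed by a Sylow p-subgroup of the group for theta. The degree for theta
    divides chi(1) = e theta(1), and being a power of p it is coprime to e. *)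
Lemma star_prop_below_prime (M K : {group gT}) :
    K \subset G -> (M <| K)%g -> prime #|K : M|%g -> p != #|K : M|%g ->
  star_prop p K -> star_prop p M.
Proof.
move=> sKG nsMK pr_q ne_pq; have sMG := subset_trans (normal_sub nsMK) sKG.
move=> /(star_propE sKG) starK; apply/(star_propE sMG) => j c cond_c a_ge2.
have p'KM : ~~ (p %| #|K : M|%g)%N by rewrite dvdn_prime2.
have [_ dv_pa] := logn_conductor_leG sMG cond_c.
have [P sylP] := Sylow_exists p (Z p :&: I j).
have sPI : P \subset I j := subset_trans (pHall_sub sylP) (subsetIr _ _).
have [i [ij fix_i [e co_pe Di]]] :=
  pgroup_fixes_over (nu_irr_action sKG) nsMK pr_p pr_q ne_pq (pHall_pgroup sylP)
    (elimT (irr_stab_fixP j P sMG) sPI).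
have [ci cond_ci] := conductor_exists nuE prim_w genL galL (charL sKG) i.
have Da : logn p ci = logn p c.
  by apply: logn_conductor_eq sKG nsMK p'KM ij cond_ci cond_c _; rewrite a_ge2 orbT.
have := starK i ci cond_ci; rewrite Da a_ge2 => /(_ isT).
have a_gt0 := ltnW a_ge2.
have dv_ji : (stardeg j (logn p c) %| stardeg i (logn p c))%N.
  by apply: (stardeg_dvd _ _ sylP) => //; apply/(irr_stab_fixP i P sKG).
have := stardeg_pnat j a_gt0 dv_pa.
rewrite Di (irr1_degree j) -natrM !dvdC_natr => p_d dv_i.
have := dvdn_trans dv_ji dv_i; rewrite Gauss_dvdr //.
by apply: pnat_coprime p_d _; rewrite p'natE // -prime_coprime.
Qed.

End Transfer.

Theorem theorem3p8 (p : nat) (gT : finGroupType) (G N : {group gT}) :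
  prime p -> (N <| G)%g -> ~~ (p %| #|(G / N)%g|)%N ->
  (star_prop p N -> star_prop p G) /\
  (solvable (G / N)%g -> star_prop p G -> star_prop p N).
Proof.
move=> pr_p nsNG; rewrite card_quotient ?normal_norm // => p'GN.
have [L galL [iota aut_f [w [prim_w genL] charG]]] := group_num_field_exists G.
pose nu (u : gal_of {:L}) := sval (aut_f u).
have nuE (u : gal_of {:L}) a : iota (u a) = nu u (iota a) := svalP (aut_f u) a.
have charL (H : {group gT}) : H \subset G ->
    forall (i : Iirr H) x, in_image iota ('chi_i x).
  move=> sHG i x; have [Hx | /cfun0->] := boolP (x \in H); last first.
    by rewrite -(rmorph0 iota) in_image_iota.
  have [|a <-] := charG _ H _ (irr_char i) x; last exact: in_image_iota.
  by rewrite order_dvdG ?(subsetP sHG).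
split=> [|solGN]; first exact: (star_prop_over nuE prim_w genL galL charL).
(* The predicate is an implication from K to N, so climbing from N to G carries the property
   down. *)
apply: (solvable_quotient_ind nsNG solGN (P := fun K => star_prop p K -> star_prop p N)) => //.
move=> M K nsNK sNM sKG nsMK pr_q dv_q starMN starK; apply: starMN.
apply: (star_prop_below_prime nuE prim_w genL galL charL pr_p sKG nsMK pr_q _ starK).
by apply: contraNneq p'GN => ->.
Qed.
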